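(* Let $\Gamma$ be a straight-line drawing of a graph $G$ whose vertex-ply is $h$. Then the ply of $\Gamma$ is at most $5h$.
   Context: A straight-line drawing of a graph $G=(V,E)$ places each vertex at a distinct point of the plane and draws each edge as the straight-line segment between its endpoints. For each vertex $v$, the ply-disk $D_v$ of $v$ is the open disk centered at $v$ whose radius $r_v$ is half the length of the longest edge incident to $v$. The ply of the drawing is the maximum, over all points $p$ of the plane, of the number of ply-disks containing $p$ in their interior. The vertex-ply of the drawing is the maximum, over all points $p$ at which a vertex of $G$ is placed, of the number of ply-disks containing $p$ in their interior. *)

(* Defs.v *)
From HB Require Import structures.
From mathcomp Require Import all_boot all_order all_algebra.
From mathcomp Require Import boolp reals.

Set Implicit Arguments.
Unset Strict Implicit.
Unset Printing Implicit Defensive.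

Import Order.TTheory GRing.Theory Num.Theory.
Local Open Scope ring_scope.

Record sgraph (V : finType) := SGraph {
  edge : rel V;
  edge_sym : symmetric edge;
  edge_irr : irreflexive edge
}.

(* Edges being straight segments, the drawing is determined by the vertex
   positions; the length of an edge is the distance between its endpoints. *)
Record drawing (R : realType) (V : finType) (G : sgraph V) := Drawing {
  pos :> V -> R * R;
  pos_inj : injective pos
}.

(* The canonical norm on R * R is the sup norm, hence the explicit formula. *)
Definition dist (R : realType) (p q : R * R) : R :=
  Num.sqrt ((p.1 - q.1) ^+ 2 + (p.2 - q.2) ^+ 2).

Section Ply.
Variables (R : realType) (V : finType) (G : sgraph V) (D : drawing R G).

(* This is 0 for an isolated vertex, whose open ply-disk is therefore empty. *)
Definition longest_edge (v : V) : R :=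
  \big[Num.max/0]_(u | edge G v u) dist (D v) (D u).

Definition ply_radius (v : V) : R := longest_edge v / 2.

Definition ply_disk (v : V) : {pred R * R} :=
  [pred p : R * R | dist (D v) p < ply_radius v].

Definition ply_at (p : R * R) : nat := #|[set v | p \in ply_disk v]|.

(* [ply_at] takes values at most #|V|, so this ranges over all its values. *)
Definition ply : nat :=
  (\max_(n < #|V|.+1 | `[< exists p : R * R, ply_at p = n >]) n)%N.

Definition vertex_ply : nat := (\max_(u : V) ply_at (D u))%N.

Lemma ply_at_le_ply (p : R * R) : (ply_at p <= ply)%N.
Proof.
have lt_p : (ply_at p < #|V|.+1)%N by rewrite ltnS max_card.
apply: (@leq_bigmax_cond _ _ (fun n : 'I_(#|V|.+1) => n : nat) (Ordinal lt_p)).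
by apply/asboolP; exists p.
Qed.

Lemma ply_attained : exists p : R * R, ply_at p = ply.
Proof.
have lt_0 : (ply_at (0%R, 0%R) < #|V|.+1)%N by rewrite ltnS max_card.
have P0 : `[< exists p : R * R, ply_at p = Ordinal lt_0 >].
  by apply/asboolP; exists (0%R, 0%R).
rewrite /ply (bigop.bigmax_eq_arg (Ordinal lt_0)) //.
by case: arg_maxnP => // n /asboolP.
Qed.

End Ply.

(* Main.v *)
Require Import Defs.
From mathcomp Require Import all_boot all_order all_algebra.
From mathcomp Require Import unstable reals.
From mathcomp Require Import ring lra.

Set Implicit Arguments.
Unset Strict Implicit.
Unset Printing Implicit Defensive.

Import Order.TTheory GRing.Theory Num.Theory.
Local Open Scope ring_scope.

(** If [u] and [v] are seen from [p] under an angle of at most 60 degrees and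
[v] is at least as close to [p] as [u], then [|uv| <= |up|]; so if the ply-disk
of [u] contains [p], it contains [v]. Cut the plane into six cones of 60 degrees
with apex [p]: the disks containing [p] whose centers lie in a given cone all
contain the center in that cone nearest to [p]. The cones can be rotated so that
the center nearest to [p] overall lies on the common boundary of two of them,
and serves both; hence five vertices pierce all disks containing [p]. *)

Section DotCross.
Variable F : comPzRingType.
Implicit Types f u v : F * F.

Definition dot u v : F := u.1 * v.1 + u.2 * v.2.

Definition cross u v : F := u.1 * v.2 - u.2 * v.1.

Lemma cross_self u : cross u u = 0.
Proof. by rewrite /cross mulrC subrr. Qed.

Lemma dot_mul_dot f u v :
  dot f f * dot u v = dot f u * dot f v + cross f u * cross f v.
Proof. by rewrite /dot /cross; ring. Qed.

Lemma dot_mul_cross f u v :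
  dot f f * cross u v = dot f u * cross f v - cross f u * dot f v.
Proof. by rewrite /dot /cross; ring. Qed.

Lemma dot_subr_self u v :
  dot (u - v) (u - v) = dot u u - dot u v *+ 2 + dot v v.
Proof. by rewrite /dot /=; ring. Qed.

End DotCross.

Lemma dot_self_ge0 (F : realDomainType) (u : F * F) : 0 <= dot u u.
Proof. by rewrite addr_ge0 // -expr2 sqr_ge0. Qed.

Lemma dot_self_eq0 (F : realDomainType) (u : F * F) : (dot u u == 0) = (u == 0).
Proof. by rewrite paddr_eq0 -?expr2 ?sqr_ge0 // !sqrf_eq0. Qed.

Lemma distE (R : realType) (p q : R * R) :
  dist p q = Num.sqrt (dot (p - q) (p - q)).
Proof. by rewrite /dist !expr2. Qed.

Lemma dist_leE (R : realType) (p q r s : R * R) :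
  (dist p q <= dist r s) = (dot (p - q) (p - q) <= dot (r - s) (r - s)).
Proof. by rewrite !distE ler_sqrt ?dot_self_ge0. Qed.

Section Cone60.
Variable F : rcfType.
Implicit Types f u v : F * F.

Local Notation sqrt3 := (Num.sqrt (3 : F)).

Lemma sqr_sqrt3 : sqrt3 ^+ 2 = 3.
Proof. exact: sqr_sqrtr. Qed.

Lemma sqrt3_gt0 : 0 < sqrt3.
Proof. by rewrite sqrtr_gt0. Qed.

(* As [sqrt3] is the tangent of 60 degrees, this says that [u] and [v] make an
   angle of at most 60 degrees. *)
Definition within60 u v : bool := `|cross u v| <= sqrt3 * dot u v.

Lemma within60_sub_le u v :
  within60 u v -> dot v v <= dot u u -> dot (u - v) (u - v) <= dot u u.
Proof.
move=> uv60 le_vu.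
have uv_ge0 : 0 <= dot u v.
  by rewrite -(pmulr_rge0 _ sqrt3_gt0) (le_trans (normr_ge0 _) uv60).
have cross_le : cross u v ^+ 2 <= 3 * dot u v ^+ 2.
  rewrite -sqr_sqrt3 -exprMn -real_normK ?num_real //.
  by rewrite ler_sqr ?nnegrE ?mulr_ge0 ?sqrtr_ge0.
have norms_le : dot u u * dot v v <= 4 * dot u v ^+ 2.
  by rewrite dot_mul_dot -!expr2; lra.
suff : dot v v <= 2 * dot u v by rewrite dot_subr_self; lra.
rewrite -ler_sqr ?nnegrE ?dot_self_ge0 ?mulr_ge0 // exprMn.
apply: le_trans (_ : dot u u * dot v v <= _); last by lra.
by rewrite expr2 ler_wpM2r ?dot_self_ge0.
Qed.

(* The vectors at a counterclockwise angle between 0 and 60 degrees from [f];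
   the whole plane if [f = 0]. *)
Definition cone60 f u : bool := 0 <= cross f u <= sqrt3 * dot f u.

Lemma cone60_self f : cone60 f f.
Proof.
by rewrite /cone60 cross_self lexx mulr_ge0 ?sqrtr_ge0 ?dot_self_ge0.
Qed.

Lemma cone60_dot_ge0 f u : cone60 f u -> 0 <= dot f u.
Proof.
by case/andP=> cross_ge0 /(le_trans cross_ge0); rewrite pmulr_rge0 ?sqrt3_gt0.
Qed.

Lemma cone60_within60 f u v :
  f != 0 -> cone60 f u -> cone60 f v -> within60 u v.
Proof.
move=> f_neq0 fu fv.
have ff_gt0 : 0 < dot f f by rewrite lt0r dot_self_eq0 f_neq0 dot_self_ge0.
have dotu_ge0 := cone60_dot_ge0 fu; have dotv_ge0 := cone60_dot_ge0 fv.
case/andP: fu => crossu_ge0 crossu_le; case/andP: fv => crossv_ge0 crossv_le.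
have dot_cross_ge0 : 0 <= dot f u * cross f v by rewrite mulr_ge0.
have cross_dot_ge0 : 0 <= cross f u * dot f v by rewrite mulr_ge0.
have cross_cross_ge0 : 0 <= sqrt3 * (cross f u * cross f v).
  by rewrite !mulr_ge0 ?sqrtr_ge0.
have dot_cross_le : dot f u * cross f v <= sqrt3 * (dot f u * dot f v).
  by rewrite mulrCA ler_wpM2l.
have cross_dot_le : cross f u * dot f v <= sqrt3 * (dot f u * dot f v).
  by rewrite mulrA ler_wpM2r.
rewrite /within60 -(ler_pM2l ff_gt0) -{1}(gtr0_norm ff_gt0) -normrM.
by rewrite mulrCA dot_mul_cross dot_mul_dot ler_norml; lra.
Qed.

Definition rot60 u : F * F :=
  ((u.1 - sqrt3 * u.2) / 2, (sqrt3 * u.1 + u.2) / 2).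

Lemma cross_rot60 f u : cross (rot60 f) u = (cross f u - sqrt3 * dot f u) / 2.
Proof. by rewrite /cross /dot /=; field. Qed.

Lemma sqrt3_dot_rot60 f u :
  sqrt3 * dot (rot60 f) u = (sqrt3 * dot f u + 3 * cross f u) / 2.
Proof. by rewrite /cross /dot /=; field: sqr_sqrt3. Qed.

Lemma dot_rot60_self f : dot (rot60 f) (rot60 f) = dot f f.
Proof. by rewrite /dot /=; field: sqr_sqrt3. Qed.

Lemma iter_rot60_neq0 f n : f != 0 -> iter n rot60 f != 0.
Proof.
by move=> f_neq0; elim: n => //= n; rewrite -!dot_self_eq0 dot_rot60_self.
Qed.

Lemma cone60_iter5_rot60_self f : cone60 (iter 5 rot60 f) f.
Proof.
rewrite /cone60 /= !(cross_rot60, sqrt3_dot_rot60) cross_self.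
have := mulr_ge0 (sqrtr_ge0 (3 : F)) (dot_self_ge0 f).
by set d := sqrt3 * _; lra.
Qed.

Lemma cone60_cover f u :
  [\/ cone60 f u, cone60 (iter 5 rot60 f) u
    | exists i : 'I_4, cone60 (iter i.+1 rot60 f) u].
Proof.
(* The six cones are cut out by the three lines on which [cross f u] or
   [sqrt3 * dot f u -/+ cross f u] vanishes. *)
have coneE := (cross_rot60, sqrt3_dot_rot60).
have [cross_ge0 | cross_lt0] := lerP 0 (cross f u).
  have [cross_le | cross_gt] := lerP (cross f u) (sqrt3 * dot f u).
    by apply: Or31; apply/andP.
  apply: Or33.
  have [opp_cross_le | opp_cross_gt] := lerP (- cross f u) (sqrt3 * dot f u).
    by exists (@Ordinal 4 0 isT); rewrite /cone60 /= !coneE; lra.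
  by exists (@Ordinal 4 1 isT); rewrite /cone60 /= !coneE; lra.
have [opp_cross_le | opp_cross_gt] := lerP (- cross f u) (sqrt3 * dot f u).
  by apply: Or32; rewrite /cone60 /= !coneE; lra.
apply: Or33; have [cross_le | cross_gt] := lerP (cross f u) (sqrt3 * dot f u).
  by exists (@Ordinal 4 3 isT); rewrite /cone60 /= !coneE; lra.
by exists (@Ordinal 4 2 isT); rewrite /cone60 /= !coneE; lra.
Qed.

End Cone60.

Arguments rot60 {F} u.

Section Ply.
Variables (R : realType) (V : finType) (G : sgraph V) (D : drawing R G).
Implicit Types (p f : R * R) (u v w : V).

Definition pierced_by (P A : {set V}) : Prop :=
  {in A, forall u, exists2 w, w \in P & D w \in ply_disk D u}.

Lemma card_pierced_le (P A : {set V}) :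
  pierced_by P A -> (#|A| <= #|P| * vertex_ply D)%N.
Proof.
move=> piercedA; pose disks_at w := [set u | D w \in ply_disk D u].
have /subset_leq_card/leq_trans-> // : A \subset \bigcup_(w in P) disks_at w.
  apply/subsetP => u /piercedA[w wP wu].
  by apply/bigcupP; exists w; rewrite ?inE.
rewrite (leq_trans (card_big_setU _ _ _)) // -sum_nat_const.
by apply: leq_sum => w _; apply: (leq_bigmax w).
Qed.

Lemma cone60_closer_in_ply_disk f p u v :
  f != 0 -> cone60 f (D u - p) -> cone60 f (D v - p) ->
  dist (D v) p <= dist (D u) p -> p \in ply_disk D u -> D v \in ply_disk D u.
Proof.
move=> f_neq0 fu fv; rewrite dist_leE !inE => le_vu; apply: le_lt_trans.
rewrite dist_leE -[D u - D v](subrKA p) -[p - D v]opprB.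
exact: within60_sub_le (cone60_within60 f_neq0 fu fv) le_vu.
Qed.

Lemma cone60_pierced_by_vertex (v0 : V) f p :
  f != 0 -> exists v, forall u,
    p \in ply_disk D u -> cone60 f (D u - p) -> D v \in ply_disk D u.
Proof.
move=> f_neq0.
pose candidate u := (p \in ply_disk D u) && cone60 f (D u - p).
have [v1 v1P | no_candidate] := pickP candidate; last first.
  by exists v0 => u pu fu; have := no_candidate u; rewrite /candidate pu fu.
have [v /andP[_ fv] v_min] := arg_minP (fun u => dist (D u) p) v1P.
exists v => u pu fu; apply: (cone60_closer_in_ply_disk f_neq0 fu fv) => //.
by apply: v_min; rewrite /candidate pu.
Qed.

Lemma five_vertices_pierce p :
  exists2 P : {set V},
    (#|P| <= 5)%N & pierced_by P [set u | p \in ply_disk D u].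
Proof.
set S := [set u | _]; have [-> | [u0 u0S]] := set_0Vmem S.
  by exists set0 => [|u]; rewrite ?cards0 ?inE.
have [w _ w_min] := arg_minP (fun u => dist (D u) p) u0S.
have [f_eq0 | f_neq0] := eqVneq (D w - p) 0.
  exists [set w] => [|u]; first by rewrite cards1.
  by rewrite inE -(subr0_eq f_eq0); exists w; rewrite ?set11.
have iter_neq0 i := iter_rot60_neq0 i f_neq0.
have /fin_all_exists[v v_pierces] (i : 'I_4) :=
  cone60_pierced_by_vertex w p (iter_neq0 i.+1).
exists (w |: [set v i | i : 'I_4]) => [|u uS].
  rewrite cardsU1; apply: (@leq_add _ _ 1 4); first exact: leq_b1.
  by rewrite (leq_trans (leq_imset_card _ _)) ?card_ord.
have pu : p \in ply_disk D u by rewrite inE in uS.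
have [fu | fu | [i fu]] := cone60_cover (D w - p) (D u - p).
- exists w; first exact: setU11.
  exact: cone60_closer_in_ply_disk f_neq0 fu (cone60_self _) (w_min u uS) pu.
- exists w; first exact: setU11.
  apply: cone60_closer_in_ply_disk (iter_neq0 5) fu _ (w_min u uS) pu.
  exact: cone60_iter5_rot60_self.
- exists (v i); first by rewrite setU1r ?imset_f.
  exact: v_pierces.
Qed.

End Ply.

Theorem theorem1 (R : realType) (V : finType) (G : sgraph V)
    (Gamma : drawing R G) (h : nat) :
  vertex_ply Gamma = h -> (ply Gamma <= 5 * h)%N.
Proof.
move=> <-; have [p <-] := ply_attained Gamma.
have [P P_le5 P_pierces] := five_vertices_pierce Gamma p.
by apply: leq_trans (card_pierced_le P_pierces) _; rewrite leq_mul2r P_le5 orbT.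
Qed.
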